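(* Let $p$ be a natural number whose last decimal digit is $1$, and let $a,b$ be natural numbers. Put $A=a+1$ and $B=b+1$. Suppose that one of the following three cases holds: (i) $p=(10a+7)(10b+3)$, with $A\ge 4$ and $B\ge 8$; (ii) $p=(10a+9)(10b+9)$, with $A\ge 2$ and $B\ge 2$; (iii) $p=(10a+1)(10b+1)$, with $A\ge 10$ and $B\ge 10$. Then $$\frac{p}{100}\le AB\le \frac{121}{10^4}\,p .$$ *)

(* Defs.v *)
From mathcomp Require Import all_boot all_order all_algebra.

(* Main.v *)
(* The ratio 100 A B / p splits as 10 A / x * 10 B / y, where x and y are the two
   factors of p; each ratio is at least 1 and decreases in A, resp. B, so only
   the smallest admissible A and B matter. There the product is 40/37 * 80/73,
   (20/19)^2 and (100/91)^2 respectively, each below 121/100. *)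
Require Import Defs.
From mathcomp Require Import all_boot all_order all_algebra.
From mathcomp Require Import zify lra.
Import Order.TTheory GRing.Theory Num.Theory.
Local Open Scope ring_scope.

(** Bounds [l / k] on [X / x] and [n / m] on [Y / y] multiply; all is cross-multiplied to stay in
    [nat], and scaling the goal by [k * m] pairs each bound with its factor. *)
Lemma leq_mul_ratio (c d k l m n x y X Y : nat) :
  (0 < k * m)%N -> (c * (l * n) <= d * (k * m))%N ->
  (k * X <= l * x)%N -> (m * Y <= n * y)%N ->
  (c * (X * Y) <= d * (x * y))%N.
Proof.
move=> km_gt0 cd hX hY; rewrite -(leq_pmul2l km_gt0).
rewrite mulnCA mulnACA (leq_trans (leq_mul (leqnn c) (leq_mul hX hY))) //.
by rewrite mulnACA !mulnA -[(c * l * n)%N]mulnA [(k * m * d)%N]mulnC -!(mulnA _ x) leq_mul.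
Qed.

Theorem theorem1 (p a b A B : nat)
  (hp : (p %% 10 = 1)%N)
  (hA : A = (a + 1)%N)
  (hB : B = (b + 1)%N)
  (hcase :
     [/\ p = ((10 * a + 7) * (10 * b + 3))%N, (4 <= A)%N & (8 <= B)%N] \/
     [/\ p = ((10 * a + 9) * (10 * b + 9))%N, (2 <= A)%N & (2 <= B)%N] \/
     [/\ p = ((10 * a + 1) * (10 * b + 1))%N, (10 <= A)%N & (10 <= B)%N]) :
  (p%:R / 100 <= A%:R * B%:R :> rat) /\
  (A%:R * B%:R <= 121 / 10 ^+ 4 * p%:R :> rat).
Proof.
suff [le_p ge_p] :
    (p <= 10 * A * (10 * B))%N /\ (100 * (10 * A * (10 * B)) <= 121 * p)%N.
  move: le_p ge_p; rewrite -!(ler_nat rat) !natrM => le_p ge_p.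
  (* Both goals are linear once the product of [A] and [B] counts as a single unknown. *)
  by split; lra.
case: hcase => [[-> leA leB]|[[-> leA leB]|[-> leA leB]]].
- split; first by apply: leq_mul; lia.
  (* At the extreme [a = 3], [b = 7] the factors are 37 and 73; [37 * (10 * A) <= 40 * (10 * a + 7)]
     amounts to [4 <= A], and likewise for [B] and in the other cases. *)
  by apply: (@leq_mul_ratio _ _ 37 40 73 80); lia.
- split; first by apply: leq_mul; lia.
  by apply: (@leq_mul_ratio _ _ 19 20 19 20); lia.
- split; first by apply: leq_mul; lia.
  by apply: (@leq_mul_ratio _ _ 91 100 91 100); lia.
Qed.
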